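(* (Rice, Shapiro) Let $A\subseteq\omega$ be an infinite c.e. set, $n\ge1$, and let $\theta^{(n)}$ be a quasi-Gödel numbering of $\mathcal S^{(n)}_A$. Then a set $X\subseteq\mathcal S^{(n)}_A$ is completely c.e. (i.e. $\{i\in\omega:\theta^{(n)}_i\in X\}$ is c.e.) if, and only if, there is a c.e. set $C\subseteq\omega$ such that $$X=\{\,r\in\mathcal S^{(n)}_A:\ (\exists i\in C)\ \mathrm{graph}(\alpha^{(n)}_i)\subseteq\mathrm{graph}(r)\,\},$$ where $\alpha^{(n)}$ is the canonical one-to-one numbering of $\mathrm{Anf}^{(n)}_A$ described in the context.
   Context: $\omega$ is the set of natural numbers; $\mathcal R^{(n)}$ is the set of total computable functions $\omega^n\to\omega$. $\langle\cdot,\cdot\rangle:\omega^2\to\omega$ is a computable bijection with $\langle x,y\rangle\ge x,y$, extended by $\langle x\rangle=x$, $\langle x_1,\dots,x_{n+1}\rangle=\langle x_1,\langle x_2,\dots,x_{n+1}\rangle\rangle$. $\mathrm{Anf}^{(n)}_A$ is the set of partial functions from $\omega^n$ to $\omega$ whose domain is either empty or equal to $\{0,\dots,a-1\}^n$ for some $a\in A$, and $\mathcal S^{(n)}_A=\mathcal R^{(n)}\cup\mathrm{Anf}^{(n)}_A$. For an $n$-ary partial function $q$, $\mathrm{graph}(q)=\{\langle\langle\vec x\rangle,q(\vec x)\rangle:\vec x\in\mathrm{dom}(q)\}$, and the extended graph of $q$ is $\{\langle\langle\vec y\rangle,0\rangle:\vec y\in\omega^n\}\cup\{\langle\langle\vec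 x\rangle,q(\vec x)+1\rangle:\vec x\in\mathrm{dom}(q)\}$. A numbering of a set $X$ is a surjection $\omega\to X$. A numbering $\theta$ of $\mathcal S^{(n)}_A$ is a quasi-Gödel numbering if: (QGN I) the extended graph of $(i,\vec x)\mapsto\theta_i(\vec x)$ is the range of a function in $\mathcal R^{(1)}$; and (QGN II) for every $k\in\mathcal R^{(2)}$ there is $v\in\mathcal R^{(1)}$ such that for all $i\in\omega$, $r\in\mathcal S^{(n)}_A$: if $\{k(i,t):t\in\omega\}$ is the extended graph of $r$, then $r=\theta_{v(i)}$. Canonical numbering $\alpha^{(n)}$: let $\kappa:\omega\to\omega^n$ be a computable bijection enumerating $\omega^n$ initial segment by initial segment, i.e. $\kappa(c)\in\{0,\dots,a-1\}^n$ iff $c<a^n$. Let $f_A\in\mathcal R^{(1)}$ have range $A$. Fix an effective bijective coding of finite sequences of natural numbers by natural numbers, with $\mathrm{lth}(a)$ the length of the sequence coded by $a$ and $(a)_j$ its $j$-th entry ($1\le j\le\mathrm{lth}(a)$). Put $\widehat\alpha_{\langle a,b\rangle}(\vec x)=(a)_{\kappa^{-1}(\vec x)+1}$ if $\kappa^{-1}(\vec x)<\min\{\mathrm{lth}(a),f_A(b)^n\}$; $=0$ if $\mathrm{lth}(a)\le\kappa^{-1}(\vec x)<f_A(b)^n$; undefined otherwise. Then $\alpha^{(n)}_0$ is the nowhere defined function, and $\alpha^{(n)}_{i+1}=\widehat\alpha_j$ for the least $j$ with $\widehat\alpha_j\notin\{\alpha^{(n)}_0,\dots,\alpha^{(n)}_i\}$.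 *)

(* Defs.v *)
From HB Require Import structures.
From mathcomp Require Import all_boot.
From mathcomp Require Import boolp classical_sets functions cardinality.

Set Implicit Arguments.
Unset Strict Implicit.
Unset Printing Implicit Defensive.

Local Open Scope classical_set_scope.

(* Total computable functions in the sense of Kleene's general recursive
   functions: minimization is applied only to functions f such that every x
   has some y with f (y, x) = 0.  By the normal form theorem these are exactly
   the partial recursive functions that happen to be total. *)
Inductive recursive : forall n, (n.-tuple nat -> nat) -> Prop :=
| recursive_zero : recursive (fun _ : 0.-tuple nat => 0)
| recursive_succ : recursive (fun x : 1.-tuple nat => (thead x).+1)
| recursive_proj n (i : 'I_n) : recursive (fun x : n.-tuple nat => tnth x i)
| recursive_comp m n (f : m.-tuple nat -> nat)
    (g : 'I_m -> n.-tuple nat -> nat) :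
    recursive f -> (forall i, recursive (g i)) ->
    recursive (fun x => f [tuple g i x | i < m])
| recursive_prim n (f : n.-tuple nat -> nat) (g : n.+2.-tuple nat -> nat)
    (h : n.+1.-tuple nat -> nat) :
    recursive f -> recursive g ->
    (forall x : n.-tuple nat, h [tuple of 0 :: x] = f x) ->
    (forall y (x : n.-tuple nat),
       h [tuple of y.+1 :: x] = g [tuple of [:: y, h [tuple of y :: x] & x]]) ->
    recursive h
| recursive_min n (f : n.+1.-tuple nat -> nat) (h : n.-tuple nat -> nat) :
    recursive f ->
    (forall x : n.-tuple nat, f [tuple of h x :: x] = 0) ->
    (forall (x : n.-tuple nat) y, y < h x -> f [tuple of y :: x] <> 0) ->
    recursive h.

Definition recursive1 (f : nat -> nat) : Prop :=
  recursive (fun x : 1.-tuple nat => f (tnth x ord0)).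

Definition recursive2 (f : nat -> nat -> nat) : Prop :=
  recursive (fun x : 2.-tuple nat => f (tnth x ord0) (tnth x ord_max)).

Definition ce (E : set nat) : Prop :=
  E = set0 \/ exists2 f, recursive1 f & E = range f.

Record pairing := Pairing {
  pair_code :> nat -> nat -> nat;
  unpair : nat -> nat * nat;
  pair_codeK : forall x y, unpair (pair_code x y) = (x, y);
  unpairK : forall z, pair_code (unpair z).1 (unpair z).2 = z;
  pair_code_ge : forall x y, (x <= pair_code x y) && (y <= pair_code x y);
  pair_code_recursive : recursive2 pair_code }.

(* <x> = x and <x_1, ..., x_(n+1)> = <x_1, <x_2, ..., x_(n+1)>>; the value on
   the empty sequence is irrelevant, arities being positive. *)
Fixpoint tuple_code (p : pairing) (s : seq nat) : nat :=
  match s with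
  | [::] => 0
  | [:: x] => x
  | x :: s' => p x (tuple_code p s')
  end.

(* None means undefined. *)
Definition partial_fun (n : nat) : Type := n.-tuple nat -> option nat.

Definition dom n (q : partial_fun n) : set (n.-tuple nat) :=
  [set x | q x <> None].

Definition box (n a : nat) : set (n.-tuple nat) :=
  [set x | forall i : 'I_n, tnth x i < a].
Arguments box : clear implicits.

Definition nowhere n : partial_fun n := fun=> None.
Arguments nowhere : clear implicits.

Definition total_recursive n : set (partial_fun n) :=
  [set q | exists2 f, recursive f & q = (fun x => Some (f x))].
Arguments total_recursive : clear implicits.

Definition Anf (A : set nat) n : set (partial_fun n) :=
  [set q | dom q = set0 \/ exists2 a, A a & dom q = box n a].
Arguments Anf : clear implicits.

Definition calS (A : set nat) n : set (partial_fun n) :=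
  total_recursive n `|` Anf A n.
Arguments calS : clear implicits.

Definition graph (p : pairing) n (q : partial_fun n) : set nat :=
  [set z | exists x y, q x = Some y /\ z = p (tuple_code p x) y].

Definition extended_graph (p : pairing) n (q : partial_fun n) : set nat :=
  [set z | exists y : n.-tuple nat, z = p (tuple_code p y) 0] `|`
  [set z | exists x y, q x = Some y /\ z = p (tuple_code p x) y.+1].

Definition universal_fun n (theta : nat -> partial_fun n) : partial_fun n.+1 :=
  fun z => theta (thead z) (behead_tuple z).

Definition numbering T (theta : nat -> T) (X : set T) : Prop := range theta = X.

Definition QGN1 (p : pairing) n (theta : nat -> partial_fun n) : Prop :=
  exists2 g, recursive1 g & extended_graph p (universal_fun theta) = range g.

Definition QGN2 (p : pairing) (A : set nat) n (theta : nat -> partial_fun n) :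
    Prop :=
  forall k, recursive2 k ->
  exists2 v, recursive1 v &
    forall i r, calS A n r -> range (k i) = extended_graph p r -> r = theta (v i).

Definition quasi_goedel (p : pairing) (A : set nat) n
    (theta : nat -> partial_fun n) : Prop :=
  [/\ numbering theta (calS A n), QGN1 p theta & QGN2 p A theta].

Record tuple_enum n := TupleEnum {
  kappa :> nat -> n.-tuple nat;
  kappa_inv : n.-tuple nat -> nat;
  kappaK : cancel kappa kappa_inv;
  kappa_invK : cancel kappa_inv kappa;
  kappa_recursive : forall j : 'I_n, recursive1 (fun c => tnth (kappa c) j);
  kappa_box : forall a c, box n a (kappa c) <-> c < a ^ n }.

Definition lth (dec : nat -> seq nat) (a : nat) : nat := size (dec a).

(* Entries are numbered from 1; the value outside 1 <= j <= lth dec a is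
   immaterial. *)
Definition entry (dec : nat -> seq nat) (a j : nat) : nat := nth 0 (dec a) j.-1.

(* Computability of encode, on sequences of any fixed length, follows by
   searching for the code. *)
Record seq_coding := SeqCoding {
  decode :> nat -> seq nat;
  encode : seq nat -> nat;
  decodeK : cancel decode encode;
  encodeK : cancel encode decode;
  lth_recursive : recursive1 (lth decode);
  entry_recursive : recursive2 (entry decode) }.

Definition alpha_hat (p : pairing) n (kap : tuple_enum n) (cod : seq_coding)
    (fA : nat -> nat) (j : nat) : partial_fun n :=
  let: (a, b) := unpair p j in
  fun x =>
    let c := kappa_inv kap x in
    if c < minn (lth cod a) (fA b ^ n) then Some (entry cod a c.+1)
    else if lth cod a <= c < fA b ^ n then Some 0
    else None.

(* The value 0 for an empty P is never used below: Anf A is infinite as soon as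
   A is. *)
Definition least (P : set nat) : nat :=
  xget 0 [set j | P j /\ forall i, P i -> j <= i].

(* alpha_upto i is the pair ({alpha_0, ..., alpha_i}, alpha_i). *)
Fixpoint alpha_upto (p : pairing) n (kap : tuple_enum n) (cod : seq_coding)
    (fA : nat -> nat) (i : nat) : set (partial_fun n) * partial_fun n :=
  match i with
  | 0 => ([set nowhere n], nowhere n)
  | i'.+1 =>
    let prev := (alpha_upto p kap cod fA i').1 in
    let next :=
      alpha_hat p kap cod fA
        (least [set j | ~ prev (alpha_hat p kap cod fA j)]) in
    (prev `|` [set next], next)
  end.

Definition alpha (p : pairing) n (kap : tuple_enum n) (cod : seq_coding)
    (fA : nat -> nat) (i : nat) : partial_fun n :=
  (alpha_upto p kap cod fA i).2.

Definition completely_ce n (theta : nat -> partial_fun n)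
    (X : set (partial_fun n)) : Prop :=
  ce [set i | X (theta i)].

(* Main.v *)
Require Import Defs.
From mathcomp Require Import all_boot.
From mathcomp Require Import boolp classical_sets functions cardinality.

(* Everything rests on the recursion theorem for [theta]: QGN II gives a recursive
   [d] such that [theta (d i)] is [theta j], [j] being the value of [theta i] at the
   [i]-th point, or nowhere defined if there is none (both lie in [calS A n]), and
   the usual diagonal argument applies.  If [X] is completely c.e., a program that
   knows its own index [e] can wait until [e] is enumerated into the index set.
   Enumerating [q], and the rest of an extension [r] of [q] once [e] shows up, yields
   upward closure.  Enumerating a total [q], and cutting the domain down to a box that
   contains the output so far once [e] shows up, yields a finite part of [q] in [X]. *)

Set Implicit Arguments.
Unset Strict Implicit.
Unset Printing Implicit Defensive.

Local Open Scope classical_set_scope.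

(** * Closure properties of recursive functions and decidable relations *)

Lemma recursive_ext n (f g : n.-tuple nat -> nat) :
  f =1 g -> recursive f -> recursive g.
Proof. by move=> /funext->. Qed.

Definition recursive_tuple m n (G : n.-tuple nat -> m.-tuple nat) :=
  forall i, recursive (fun x => tnth (G x) i).

Lemma rec_comp m n (f : m.-tuple nat -> nat) (G : n.-tuple nat -> m.-tuple nat) :
  recursive f -> recursive_tuple G -> recursive (fun x => f (G x)).
Proof.
move=> rf rG; apply: recursive_ext (recursive_comp rf rG) => x /=.
by congr f; apply: eq_from_tnth => i; rewrite tnth_mktuple.
Qed.

Lemma rec_tuple_id n : recursive_tuple (fun x : n.-tuple nat => x).
Proof. exact: recursive_proj. Qed.

Lemma rec_tuple_behead m n (G : n.-tuple nat -> m.+1.-tuple nat) :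
  recursive_tuple G -> recursive_tuple (fun x => behead_tuple (G x)).
Proof.
move=> rG i; apply: recursive_ext (rG (lift ord0 i)) => x.
by rewrite [G x]tuple_eta tnthS; congr tnth; apply: val_inj.
Qed.

Lemma rec_tuple_cons m n (f : n.-tuple nat -> nat) (G : n.-tuple nat -> m.-tuple nat) :
  recursive f -> recursive_tuple G ->
  recursive_tuple (fun x => cons_tuple (f x) (G x)).
Proof.
move=> rf rG i; case: (unliftP ord0 i) => [j|] ->.
  apply: recursive_ext (rG j) => x; rewrite /=.
  by rewrite !(tnth_nth 0).
by apply: recursive_ext rf => x; rewrite (tnth_nth 0).
Qed.

Lemma rec_tuple_nil n : recursive_tuple (fun _ : n.-tuple nat => [tuple of nil]).
Proof. by case. Qed.

Lemma rec_tnth m n (G : n.-tuple nat -> m.-tuple nat) i :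
  recursive_tuple G -> recursive (fun x => tnth (G x) i).
Proof. exact. Qed.

Lemma rec_thead m n (G : n.-tuple nat -> m.+1.-tuple nat) :
  recursive_tuple G -> recursive (fun x => thead (G x)).
Proof. by move=> rG; apply: rG. Qed.

Lemma rec_S n (f : n.-tuple nat -> nat) :
  recursive f -> recursive (fun x => (f x).+1).
Proof.
move=> rf; have := rec_comp recursive_succ (rec_tuple_cons rf (@rec_tuple_nil n)).
by apply: recursive_ext.
Qed.

Lemma rec_const n c : recursive (fun _ : n.-tuple nat => c).
Proof.
elim: c => [|c]; last exact: rec_S.
exact: rec_comp recursive_zero (@rec_tuple_nil n).
Qed.

Lemma recursive1P h : recursive1 h ->
  forall n (f : n.-tuple nat -> nat), recursive f -> recursive (fun x => h (f x)).
Proof.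
move=> rh n f rf.
have := rec_comp rh (rec_tuple_cons rf (@rec_tuple_nil n)).
by apply: recursive_ext.
Qed.

Lemma recursive2P h : recursive2 h ->
  forall n (f g : n.-tuple nat -> nat), recursive f -> recursive g ->
  recursive (fun x => h (f x) (g x)).
Proof.
move=> rh n f g rf rg.
have := rec_comp rh (rec_tuple_cons rf (rec_tuple_cons rg (@rec_tuple_nil n))).
by apply: recursive_ext.
Qed.

Lemma behead_tuple_cons n y (x : n.-tuple nat) : behead_tuple (cons_tuple y x) = x.
Proof. exact: val_inj. Qed.

Lemma thead_cons n y (x : n.-tuple nat) : thead (cons_tuple y x) = y.
Proof. by []. Qed.

(** Primitive recursion with [x] as parameter: the step sees the counter and the accumulator, placed
    in front of [x]. Arithmetic and bounded quantifiers are obtained from it. *)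
Lemma rec_iteri n (b f : n.-tuple nat -> nat) (g : n.-tuple nat -> nat -> nat -> nat) :
  recursive b -> recursive f ->
  recursive (fun z : n.+2.-tuple nat =>
    g (behead_tuple (behead_tuple z)) (thead z) (thead (behead_tuple z))) ->
  recursive (fun x => iteri (b x) (g x) (f x)).
Proof.
move=> rb rf rg.
pose h (z : n.+1.-tuple nat) := iteri (thead z) (g (behead_tuple z)) (f (behead_tuple z)).
suff rh : recursive h.
  have := rec_comp rh (rec_tuple_cons rb (@rec_tuple_id n)).
  by apply: recursive_ext => x; rewrite /h thead_cons behead_tuple_cons.
apply: (recursive_prim rf rg) => [x|y x]; rewrite /h !thead_cons ?behead_tuple_cons //.
Qed.

(** Quantifying over the argument functions builds closure under substitution into the notion. In
    use the arguments are an index, the number of a point, a value and a stage. *)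
Definition recursive_rel4 (R : nat -> nat -> nat -> nat -> bool) :=
  forall n (f1 f2 f3 f4 : n.-tuple nat -> nat),
    recursive f1 -> recursive f2 -> recursive f3 -> recursive f4 ->
    recursive (fun x => nat_of_bool (R (f1 x) (f2 x) (f3 x) (f4 x))).

Ltac rec_base :=
  match goal with
  | |- recursive_tuple (fun x => x) => apply: rec_tuple_id
  | |- recursive_tuple _ => apply: rec_tuple_behead
  | H : recursive ?f |- recursive ?f => exact: H
  | |- recursive (fun _ => ?c) => apply: rec_const
  | |- recursive (fun x => (_ _).+1) => apply: rec_S
  | |- recursive (fun x => thead _) => apply: rec_thead
  | |- recursive (@thead _ _) => exact: (rec_thead (@rec_tuple_id _))
  | |- recursive (fun x => tnth _ _) => apply: rec_tnth
  | H : recursive ?f |- recursive (fun x => ?f (@?G x)) => apply: (rec_comp H)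
  | H : recursive ?f |- recursive (fun x => nat_of_bool (?b (@?G x))) =>
      apply: (rec_comp H)
  | H : recursive1 ?f |- recursive (fun x => ?f (@?G x)) => apply: (recursive1P H)
  | H : recursive2 ?f |- recursive (fun x => ?f (@?F x) (@?G x)) =>
      apply: (recursive2P H)
  | H : recursive_rel4 ?R |- recursive (fun x => nat_of_bool (?R _ _ _ _)) =>
      apply: H
  end.

Lemma rec_addn n (f g : n.-tuple nat -> nat) :
  recursive f -> recursive g -> recursive (fun x => f x + g x).
Proof.
move=> rf rg.
apply: (@recursive_ext _ (fun x => iteri (g x) (fun _ r => r.+1) (f x))) => [x|].
  by elim: (g x) => [|m IH]; rewrite ?addn0 // addnS -IH.
by apply: rec_iteri; repeat rec_base.
Qed.

Lemma rec_predn n (f : n.-tuple nat -> nat) :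
  recursive f -> recursive (fun x => (f x).-1).
Proof.
move=> rf.
apply: (@recursive_ext _ (fun x => iteri (f x) (fun y _ => y) 0)) => [x|].
  by case: (f x).
by apply: rec_iteri; repeat rec_base.
Qed.

Lemma rec_subn n (f g : n.-tuple nat -> nat) :
  recursive f -> recursive g -> recursive (fun x => f x - g x).
Proof.
move=> rf rg.
apply: (@recursive_ext _ (fun x => iteri (g x) (fun _ r => r.-1) (f x))) => [x|].
  by elim: (g x) => [|m IH]; rewrite ?subn0 // subnS -IH.
by apply: rec_iteri => //; apply: rec_predn; repeat rec_base.
Qed.

Lemma rec_muln n (f g : n.-tuple nat -> nat) :
  recursive f -> recursive g -> recursive (fun x => f x * g x).
Proof.
move=> rf rg.
apply: (@recursive_ext _ (fun x => iteri (g x) (fun _ r => f x + r) 0)) => [x|].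
  by elim: (g x) => [|m IH]; rewrite ?muln0 // mulnS -IH.
apply: rec_iteri; [by []|exact: rec_const|].
by apply: rec_addn; repeat rec_base.
Qed.

Lemma rec_expn n (f g : n.-tuple nat -> nat) :
  recursive f -> recursive g -> recursive (fun x => f x ^ g x).
Proof.
move=> rf rg.
apply: (@recursive_ext _ (fun x => iteri (g x) (fun _ r => f x * r) 1)) => [x|].
  by elim: (g x) => [|m IH]; rewrite ?expn0 // expnS -IH.
apply: rec_iteri; [by []|exact: rec_const|].
by apply: rec_muln; repeat rec_base.
Qed.

Lemma rec_neg n (b : n.-tuple nat -> bool) :
  recursive (fun x => nat_of_bool (b x)) -> recursive (fun x => nat_of_bool (~~ b x)).
Proof.
move=> rb.
apply: (@recursive_ext _ (fun x => 1 - b x)) => [x|]; first by case: (b x).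
by apply: rec_subn; repeat rec_base.
Qed.

Lemma rec_if n (b : n.-tuple nat -> bool) (f g : n.-tuple nat -> nat) :
  recursive (fun x => nat_of_bool (b x)) -> recursive f -> recursive g ->
  recursive (fun x => if b x then f x else g x).
Proof.
move=> rb rf rg.
apply: (@recursive_ext _ (fun x => b x * f x + ~~ b x * g x)) => [x|].
  by case: (b x); rewrite ?mul1n ?addn0.
by apply: rec_addn; apply: rec_muln => //; apply: rec_neg.
Qed.

Lemma rec_and n (b c : n.-tuple nat -> bool) :
  recursive (fun x => nat_of_bool (b x)) -> recursive (fun x => nat_of_bool (c x)) ->
  recursive (fun x => nat_of_bool (b x && c x)).
Proof.
move=> rb rc.
apply: (@recursive_ext _ (fun x => b x * c x)) => [x|]; first by rewrite mulnb.
exact: rec_muln.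
Qed.

Lemma rec_or n (b c : n.-tuple nat -> bool) :
  recursive (fun x => nat_of_bool (b x)) -> recursive (fun x => nat_of_bool (c x)) ->
  recursive (fun x => nat_of_bool (b x || c x)).
Proof.
move=> rb rc.
apply: (@recursive_ext _ (fun x => nat_of_bool (~~ (~~ b x && ~~ c x)))) => [x|].
  by rewrite negb_and !negbK.
by apply/rec_neg/rec_and; apply: rec_neg.
Qed.

Lemma rec_leq n (f g : n.-tuple nat -> nat) :
  recursive f -> recursive g -> recursive (fun x => nat_of_bool (f x <= g x)).
Proof.
move=> rf rg.
apply: (@recursive_ext _ (fun x => 1 - (f x - g x))) => [x|].
  by rewrite /leq; case: (f x - g x).
by apply: rec_subn; [exact: rec_const|exact: rec_subn].
Qed.

Lemma rec_eqn n (f g : n.-tuple nat -> nat) :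
  recursive f -> recursive g -> recursive (fun x => nat_of_bool (f x == g x)).
Proof.
move=> rf rg.
apply: (@recursive_ext _ (fun x => nat_of_bool ((f x <= g x) && (g x <= f x)))) => [x|].
  by rewrite eqn_leq.
by apply: rec_and; apply: rec_leq.
Qed.

Lemma rec_all n (R : n.-tuple nat -> nat -> bool) (b : n.-tuple nat -> nat) :
  recursive (fun z : n.+1.-tuple nat => nat_of_bool (R (behead_tuple z) (thead z))) ->
  recursive b -> recursive (fun x => nat_of_bool (all (R x) (iota 0 (b x)))).
Proof.
move=> rR rb.
apply: (@recursive_ext _ (fun x => iteri (b x) (fun y r => r * R x y) 1)) => [x|].
  elim: (b x) => [//|m IH]; rewrite iteriS IH -addn1 iotaD all_cat /= add0n.
  by rewrite andbT mulnb.
apply: rec_iteri; [by []|exact: rec_const|].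
apply: rec_muln; first by repeat rec_base.
(* [R] does not see the accumulator, the second entry of [z]; the substitution drops it. *)
have := rec_comp rR (rec_tuple_cons (f := fun z : n.+2.-tuple nat => thead z)
  (G := fun z : n.+2.-tuple nat => behead_tuple (behead_tuple z)) _ _).
move=> H; apply: recursive_ext (H _ _) => [z||]; [|by repeat rec_base..].
by rewrite thead_cons behead_tuple_cons.
Qed.

Lemma rec_has n (R : n.-tuple nat -> nat -> bool) (b : n.-tuple nat -> nat) :
  recursive (fun z : n.+1.-tuple nat => nat_of_bool (R (behead_tuple z) (thead z))) ->
  recursive b -> recursive (fun x => nat_of_bool (has (R x) (iota 0 (b x)))).
Proof.
move=> rR rb.
apply: (@recursive_ext _ (fun x =>
    nat_of_bool (~~ all (fun y => ~~ R x y) (iota 0 (b x))))) => [x|].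
  by rewrite -has_predC; congr nat_of_bool; apply: eq_has => y /=; rewrite negbK.
by apply/rec_neg/rec_all => //; apply: rec_neg.
Qed.

Lemma rec_search n (R : n.-tuple nat -> nat -> bool) :
  recursive (fun z : n.+1.-tuple nat => nat_of_bool (R (behead_tuple z) (thead z))) ->
  (forall x, exists y, R x y) ->
  exists2 h, recursive h & forall x, R x (h x) /\ forall y, R x y -> h x <= y.
Proof.
move=> rR exR; exists (fun x => ex_minn (exR x)); last first.
  by move=> x; case: ex_minnP.
apply: (recursive_min (rec_neg rR)) => [x|x y] /=;
  rewrite thead_cons behead_tuple_cons; case: ex_minnP => m Rm min_m.
  by rewrite Rm.
by case Rxy: (R x y) => //; rewrite ltnNge min_m.
Qed.

Ltac rec_step :=
  first [ rec_base |
  match goal with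
  | |- recursive (fun x => _ + _) => apply: rec_addn
  | |- recursive (fun x => _ * _) => apply: rec_muln
  | |- recursive (fun x => _ ^ _) => apply: rec_expn
  | |- recursive (fun x => _.-1) => apply: rec_predn
  | |- recursive (fun x => _ - _) => apply: rec_subn
  | |- recursive (fun x => if _ then _ else _) => apply: rec_if
  | |- recursive (fun x => nat_of_bool (_ == _)) => apply: rec_eqn
  | |- recursive (fun x => nat_of_bool (_ <= _)) => apply: rec_leq
  | |- recursive (fun x => nat_of_bool (_ && _)) => apply: rec_and
  | |- recursive (fun x => nat_of_bool (_ || _)) => apply: rec_or
  | |- recursive (fun x => nat_of_bool (~~ _)) => apply: rec_neg
  | |- recursive (fun x => nat_of_bool (all _ _)) => apply: rec_all
  | |- recursive (fun x => nat_of_bool (has _ _)) => apply: rec_has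
  end].

Ltac rec := repeat (cbv beta; rec_step).
(** Searching for the only [y] with [R x y] computes [h], so a decidable graph suffices; inverses of
    coding functions are handled this way. *)
Lemma rec_unique n (R : n.-tuple nat -> nat -> bool) (h : n.-tuple nat -> nat) :
  recursive (fun z : n.+1.-tuple nat => nat_of_bool (R (behead_tuple z) (thead z))) ->
  (forall x y, R x y = (y == h x)) -> recursive h.
Proof.
move=> rR Rh; have [x|h' rh' Rh'] := rec_search rR; first by exists (h x); rewrite Rh.
by apply: recursive_ext rh' => x; have [] := Rh' x; rewrite Rh => /eqP.
Qed.

(** * Projections of the pairing, codes of tuples, and graphs *)

Section Pairing.
Variable p : pairing.

Lemma pair_code_inj x y x' y' : p x y = p x' y' -> x = x' /\ y = y'.
Proof. by move=> /(congr1 (unpair p)); rewrite !pair_codeK => -[]. Qed.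

Lemma rec_pair : recursive2 p.
Proof. exact: pair_code_recursive. Qed.

Definition pr1 z := (unpair p z).1.
Definition pr2 z := (unpair p z).2.

Lemma pr1K x y : pr1 (p x y) = x. Proof. by rewrite /pr1 pair_codeK. Qed.
Lemma pr2K x y : pr2 (p x y) = y. Proof. by rewrite /pr2 pair_codeK. Qed.
Lemma prK z : p (pr1 z) (pr2 z) = z. Proof. exact: unpairK. Qed.

(** A component is at most its code, so the missing one is found by bounded search and the graph of
    the projection is decidable. *)
Lemma rec_pr1 : recursive1 pr1.
Proof.
have rp := rec_pair.
apply: (@rec_unique _ (fun x y =>
  has (fun b => p y b == tnth x ord0) (iota 0 (tnth x ord0).+1))); first by rec.
move=> x y; set z := tnth x ord0; apply/hasP/eqP => [[b _ /eqP <-]|->].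
  by rewrite pr1K.
exists (pr2 z); last by rewrite prK.
by have := pair_code_ge p (pr1 z) (pr2 z); rewrite prK mem_iota add0n ltnS => /andP[].
Qed.

Lemma rec_pr2 : recursive1 pr2.
Proof.
have rp := rec_pair.
apply: (@rec_unique _ (fun x y =>
  has (fun b => p b y == tnth x ord0) (iota 0 (tnth x ord0).+1))); first by rec.
move=> x y; set z := tnth x ord0; apply/hasP/eqP => [[b _ /eqP <-]|->].
  by rewrite pr2K.
exists (pr1 z); last by rewrite prK.
by have := pair_code_ge p (pr1 z) (pr2 z); rewrite prK mem_iota add0n ltnS => /andP[].
Qed.

(** The code does not record the length, so the induction carries along that both sequences have the
    same size. *)
Lemma tuple_code_inj n : injective (fun x : n.-tuple nat => tuple_code p x).
Proof.
move=> x y /= xy; apply: val_inj; move: xy => /=.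
have: size x = size y by rewrite !size_tuple.
elim: (val x) (val y) => [|a [|b s] IH] [|a' [|b' s']] //=; first by move=> _ ->.
move=> -[ss] /pair_code_inj [-> e]; congr cons.
by apply: IH; rewrite /= ?ss.
Qed.

Lemma rec_tuple_code m n (G : n.-tuple nat -> m.-tuple nat) :
  recursive_tuple G -> recursive (fun x => tuple_code p (G x)).
Proof.
move=> rG; have rp := rec_pair.
apply: (@recursive_ext _ (fun x => tuple_code p [seq tnth (G x) i | i <- enum 'I_m])).
  by move=> x; rewrite map_tnth_enum.
elim: (enum 'I_m) => [|i [|j s] IH] /=; [by rec|by rec|].
by apply: (recursive2P rp) => //; rec.
Qed.

Lemma extended_graph_succ n (q : partial_fun n) (x : n.-tuple nat) y :
  extended_graph p q (p (tuple_code p x) y.+1) <-> q x = Some y.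
Proof.
split=> [|qxy]; last by right; exists x, y.
by case=> [[x' /pair_code_inj[]//]|[x' [y' [qx /pair_code_inj[/tuple_code_inj -> [->]]]]]].
Qed.

Lemma graph_subset n (q r : partial_fun n) :
  graph p q `<=` graph p r <-> forall x y, q x = Some y -> r x = Some y.
Proof.
split=> qr => [x y qx|_ [x [y [qx ->]]]]; last by exists x, y; split=> //; exact: qr.
have [|x' [y' [rx /pair_code_inj[/tuple_code_inj -> ->]]]//] := qr (p (tuple_code p x) y).
by exists x, y.
Qed.

End Pairing.

Ltac rec_pairs := 
  repeat first [progress cbv beta | rec_step | exact: rec_pair | exact: rec_pr1
    | exact: rec_pr2
    | apply: (recursive1P (rec_pr1 _)) | apply: (recursive1P (rec_pr2 _))
    | apply: (recursive2P (rec_pair _))].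

(** * Enumerations, unboundedness and searches *)

Lemma ce_projection (p : pairing) (R : nat -> nat -> bool) :
  (forall n (f g : n.-tuple nat -> nat), recursive f -> recursive g ->
     recursive (fun x => nat_of_bool (R (f x) (g x)))) ->
  ce [set i | exists t, R i t].
Proof.
move=> rR; have [[i0 [t0 R0]]|none] := pselect (exists i t, R i t); last first.
  by left; apply/seteqP; split=> // i [t Rit]; case: none; exists i, t.
(* A number that does not code a member with its witness outputs the fixed member [i0]; this default
   is why the empty set is treated apart. *)
right; exists (fun z => if R (pr1 p z) (pr2 p z) then pr1 p z else i0).
  by apply: rec_if; [apply: rR|..]; rec_pairs.
apply/seteqP; split=> [i [t Rit]|_ [z _ <-]] /=.
  by exists (p i t); rewrite ?pr1K ?pr2K ?Rit.
by case: ifP => Rz; [exists (pr2 p z)|exists t0].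
Qed.

Lemma infinite_unbounded (A : set nat) : infinite_set A ->
  forall m, exists2 a, A a & m < a.
Proof.
move=> infA m; apply: contrapT => noa; apply: infA.
apply: (@sub_finite_set _ _ `I_m.+1); last exact: finite_II.
by move=> a Aa /=; rewrite ltnS leqNgt; apply/negP => ma; apply: noa; exists a.
Qed.

Lemma leq_self_exp a n : 0 < n -> a <= a ^ n.
Proof. by case: a => // a n_gt0; rewrite -{1}(expn1 a.+1) leq_pexp2l. Qed.

(* Partial functions are handled through [c |-> q (kap c)], which turns boxes
   into initial segments. *)
Definition enumerates n (kap : tuple_enum n) (R : nat -> nat -> nat -> bool)
    (q : partial_fun n) :=
  forall c y, q (kap c) = Some y <-> exists t, R c y t.

Lemma recursive1_search (R : nat -> nat -> bool) :
  recursive2 (fun x y => nat_of_bool (R x y)) -> (forall x, exists y, R x y) ->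
  exists2 h, recursive1 h & forall x, R x (h x) /\ forall y, R x y -> h x <= y.
Proof.
move=> rR exR.
have rR1 : recursive (fun z : 2.-tuple nat =>
    nat_of_bool (R (tnth (behead_tuple z) ord0) (thead z))).
  by refine (recursive2P rR (f := fun z : 2.-tuple nat => tnth (behead_tuple z) ord0)
    (g := fun z : 2.-tuple nat => thead z) _ _); rec.
have [x|h rh hE] := rec_search (R := fun x : 1.-tuple nat => R (tnth x ord0)) rR1.
  exact: exR.
exists (fun x => h [tuple x]) => [|x]; last by have := hE [tuple x]; rewrite (tnth_nth 0).
apply: recursive_ext rh => x; congr h; apply: eq_from_tnth => j.
by rewrite !ord1.
Qed.

Lemma eq_kappa n (kap : tuple_enum n) (q r : partial_fun n) :
  (forall c, q (kap c) = r (kap c)) -> q = r.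
Proof. by move=> qr; apply/funext => x; rewrite -(kappa_invK kap x). Qed.

Lemma leastE (P : set nat) m : P m -> (forall j, P j -> m <= j) -> least P = m.
Proof.
move=> Pm m_min; rewrite /least; case: xgetP => [j _ [Pj j_min]|/(_ m)[]//].
by apply/eqP; rewrite eqn_leq j_min ?m_min.
Qed.

(** * Effectiveness of the canonical numbering *)

Section Alpha.
Variables (p : pairing) (cod : seq_coding) (A : set nat) (fA : nat -> nat).
Variables (n : nat) (kap : tuple_enum n).
Hypotheses (n_gt0 : 0 < n) (A_infinite : infinite_set A).
Hypotheses (fA_recursive : recursive1 fA) (fA_range : range fA = A).

Let ahat := alpha_hat p kap cod fA.

(** Read along [kap], the function [ahat j] lives on the initial segment of length [hat_size j],
    with values [hat_value j], which include the padding by 0. Equality of two such functions is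
    thereby a finite check. *)
Definition hat_size j := fA (pr2 p j) ^ n.
Definition hat_value j c :=
  if c < lth cod (pr1 p j) then entry cod (pr1 p j) c.+1 else 0.

Lemma rec_hat_size : recursive1 hat_size.
Proof. by rewrite /recursive1 /hat_size; rec_pairs. Qed.

Lemma rec_hat_value : recursive2 hat_value.
Proof.
have rl := lth_recursive cod; have re := entry_recursive cod.
by rewrite /recursive2 /hat_value; rec_pairs.
Qed.

Lemma alpha_hatE j c :
  ahat j (kap c) = if c < hat_size j then Some (hat_value j c) else None.
Proof.
rewrite /ahat /alpha_hat /hat_size /hat_value /pr1 /pr2.
case: (unpair p j) => a b /=; rewrite kappaK leq_min.
by case: (ltnP c (lth cod a)); case: (ltnP c (fA b ^ n)).
Qed.

Definition same_hat j j' :=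
  (hat_size j == hat_size j') &&
  all (fun c => hat_value j c == hat_value j' c) (iota 0 (hat_size j)).

Lemma same_hatP j j' : reflect (ahat j = ahat j') (same_hat j j').
Proof.
apply: (iffP andP) => [[/eqP ss /allP vv]|eq_hat].
  apply: (@eq_kappa _ kap) => c; rewrite !alpha_hatE -ss; case: ifP => // c_lt.
  by congr Some; apply/eqP/vv; rewrite mem_iota.
have hatE c : ahat j (kap c) = ahat j' (kap c) by rewrite eq_hat.
have ss : hat_size j = hat_size j'.
  (* If the sizes differed, the point numbered by the smaller one would lie in exactly one of the
     two domains. *)
  apply/eqP; rewrite eqn_leq !(leqNgt (hat_size _)); apply/andP; split; apply/negP => lt.
    by have := hatE (hat_size j'); rewrite !alpha_hatE lt ltnn.
  by have := hatE (hat_size j); rewrite !alpha_hatE lt ltnn.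
split; first exact/eqP.
apply/allP => c; rewrite mem_iota /= add0n => c_lt.
by have := hatE c; rewrite !alpha_hatE -ss c_lt => -[->].
Qed.

Lemma hat_nowhere j : ahat j = nowhere n <-> hat_size j = 0.
Proof.
split=> [hat0|size0].
  have := congr1 (@^~ (kap 0)) hat0; rewrite /= alpha_hatE.
  by case: (hat_size j).
by apply: (@eq_kappa _ kap) => c; rewrite alpha_hatE size0.
Qed.

(** Comparing with every index below [b], instead of with the functions listed so far, keeps the
    test decidable. Positive size excludes the nowhere defined function, which is [alpha 0]. *)
Definition fresh b j :=
  (0 < hat_size j) && all (fun j' => ~~ same_hat j' j) (iota 0 b).

Lemma freshP b j : fresh b j <->
  ~ (ahat j = nowhere n \/ exists2 j', j' < b & ahat j = ahat j').
Proof.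
rewrite hat_nowhere /fresh lt0n; split.
  move=> /andP[/eqP sz /allP new] [//|[j' j'b /esym/same_hatP same]].
  by have := new j'; rewrite mem_iota same /= add0n j'b => /(_ isT).
move=> new; apply/andP; split; first by apply/eqP => sz; apply: new; left.
apply/allP => j'; rewrite mem_iota /= add0n => j'b; apply/negP => /same_hatP same.
by apply: new; right; exists j'.
Qed.

(** As [A] is unbounded, some box has more points than every domain with index below [b]; only its
    size matters, hence the arbitrary code 0 for the values. *)
Lemma fresh_exists b : exists j, fresh b j.
Proof.
have [a Aa a_gt] := infinite_unbounded A_infinite (\max_(j < b) hat_size j).
move: (Aa); rewrite -fA_range => -[k _ ka].
have size_k : \max_(j < b) hat_size j < hat_size (p 0 k).
  by rewrite /hat_size pr2K ka (leq_trans a_gt) ?leq_self_exp.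
exists (p 0 k); rewrite /fresh (leq_ltn_trans _ size_k) //=.
apply/allP => j; rewrite mem_iota /= add0n => j_lt; apply/negP => /andP[/eqP ss _].
move: size_k; rewrite -ss ltnNge.
by rewrite (@leq_bigmax _ (fun j : 'I_b => hat_size j) (Ordinal j_lt)).
Qed.

Lemma Anf_hat q : Anf A n q -> q = nowhere n \/ exists j, q = ahat j.
Proof.
case=> [dom0|[a]]; first left.
  apply/funext => x; case qx: (q x) => [y|//].
  have dx : dom q x by rewrite /dom /= qx.
  by move: dx; rewrite dom0.
rewrite -{1}fA_range => -[b _ <-] domq; right.
have dom_c c : q (kap c) <> None <-> c < fA b ^ n.
  by rewrite -(kappa_box kap) -domq.
(* Code the list of all values of [q] on its box in the order of [kap]; its length is the size of
   the box, so nothing is padded. *)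
exists (p (encode cod [seq odflt 0 (q (kap c)) | c <- iota 0 (fA b ^ n)]) b).
apply: (@eq_kappa _ kap) => c.
rewrite alpha_hatE /hat_size /hat_value !(pr1K, pr2K) /lth /entry encodeK.
rewrite size_map size_iota; have := dom_c c.
case: ltnP => c_lt [dom1 dom2]; last by case: (q _) dom1 => // y /(_ _)-/(_ _)[].
rewrite (nth_map 0) ?size_iota // nth_iota // add0n.
by case: (q _) dom2 => // /(_ isT).
Qed.

Lemma hat_Anf j : Anf A n (ahat j).
Proof.
right; exists (fA (pr2 p j)); first by rewrite -fA_range; exists (pr2 p j).
apply/seteqP; split=> x; have := kappa_box kap (fA (pr2 p j)) (kappa_inv kap x);
  have := alpha_hatE j (kappa_inv kap x); rewrite kappa_invK /dom /= => -> box_x.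
  by case: ifP => // c_lt _; apply/box_x.
by move/box_x => c_lt; rewrite /hat_size c_lt.
Qed.

(** Each step of the construction is a search for the least fresh index, so iterating this search
    computes an [alpha_hat] index of each [alpha i.+1]. *)
Lemma alpha_effective : exists sz v, [/\ recursive1 sz, recursive2 v,
  forall i c, alpha p kap cod fA i (kap c) = if c < sz i then Some (v i c) else None &
  Anf A n = range (alpha p kap cod fA)].
Proof.
have rs := rec_hat_size; have rv := rec_hat_value.
have [||next rnext nextE] := @recursive1_search fresh.
- by rewrite /recursive2 /fresh /same_hat; rec.
- exact: fresh_exists.
(* [alpha 0], ..., [alpha i] are the nowhere defined function and the [ahat j] with
   [j < B i]. *)
pose B i := iteri i (fun _ r => (next r).+1) 0.
have rB : recursive1 B by apply: rec_iteri; rec.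
have prevE i : (alpha_upto p kap cod fA i).1 =
    [set q | q = nowhere n \/ exists2 j, j < B i & q = ahat j] /\
    alpha p kap cod fA i.+1 = ahat (next (B i)).
  have least_fresh i' : (alpha_upto p kap cod fA i').1 =
      [set q | q = nowhere n \/ exists2 j, j < B i' & q = ahat j] ->
      alpha p kap cod fA i'.+1 = ahat (next (B i')).
    rewrite /alpha /= => ->; congr ahat; have [Bnew Bmin] := nextE (B i').
    by apply: leastE => [|j /freshP/Bmin//]; apply/freshP.
  elim: i => [|i [IH _]].
    have E0 : (alpha_upto p kap cod fA 0).1 =
        [set q | q = nowhere n \/ exists2 j, j < B 0 & q = ahat j].
      by apply/seteqP; split=> [q ->|q [->|[]]//]; left.
    by split=> //; apply: least_fresh.
  have ES : (alpha_upto p kap cod fA i.+1).1 =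
      [set q | q = nowhere n \/ exists2 j, j < B i.+1 & q = ahat j].
    have := least_fresh i IH; rewrite /alpha /= => ->; rewrite IH.
    have [Bnew Bmin] := nextE (B i).
    (* An index below [B i] is not fresh, since it is compared with itself. *)
    have B_le : B i <= next (B i).
      rewrite leqNgt; apply/negP => lt; have /freshP[] := Bnew.
      by right; exists (next (B i)).
    apply/seteqP; split=> q /=.
      case=> [[->|[j j_lt ->]]|->]; [by left|right..].
        by exists j => //; rewrite ltnS (leq_trans (ltnW j_lt)).
      by exists (next (B i)).
    case=> [->|[j]]; first by left; left.
    rewrite ltnS leq_eqVlt => /orP[/eqP -> ->|j_lt ->]; first by right.
    (* An index passed over by the search is not fresh, so its function is already in the list. *)
    left; apply: contrapT => /freshP/Bmin; by rewrite leqNgt j_lt.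
  by split=> //; apply: least_fresh.
(* Consequently [j < B j.+1], so that every [ahat j] is listed by stage [j.+1]. *)
have B_ge i : i <= B i.
  elim: i => // i IH; rewrite /B iteriS -/(B i) ltnS (leq_trans IH) //.
  have [/freshP Bnew _] := nextE (B i); rewrite leqNgt; apply/negP => lt.
  by apply: Bnew; right; exists (next (B i)).
(* As [B i.+1] is the successor of [next (B i)], its predecessor is an index of [alpha i.+1]; size 0
   yields [alpha 0]. *)
exists (fun i => if i == 0 then 0 else hat_size (B i).-1),
  (fun i c => hat_value (B i).-1 c); split.
- by rewrite /recursive1; rec.
- by rewrite /recursive2; rec.
- case=> [|i] c //; have [_ ->] := prevE i; rewrite alpha_hatE.
  by rewrite /B iteriS.
- apply/seteqP; split=> [q Aq|_ [[|i] _ <-]]; last first.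
  + by have [_ ->] := prevE i; exact: hat_Anf.
  + by left; apply/seteqP; split.
  have [i] : exists i, (alpha_upto p kap cod fA i).1 q.
    have [->|[j ->]] := Anf_hat Aq; first by exists 0.
    by exists j.+1; have [-> _] := prevE j.+1; right; exists j.
  elim: i => [->|i IH [//|->]]; first by exists 0.
  by exists i.+1.
Qed.

End Alpha.

(** * Universal enumeration, realization and the recursion theorem for [theta] *)

Section QuasiGoedel.
Variables (p : pairing) (A : set nat) (n : nat) (kap : tuple_enum n).

Definition kcode c := tuple_code p (kap c).

Lemma rec_kcode : recursive1 kcode.
Proof.
apply: rec_tuple_code => i.
exact: (recursive1P (kappa_recursive kap i) (rec_tnth _ (@rec_tuple_id _))).
Qed.

Lemma rec_kappa_inv : recursive (kappa_inv kap).
Proof.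
have rk := rec_kcode; have rt := rec_tuple_code p (@rec_tuple_id n).
apply: (@rec_unique _ (fun x c => kcode c == tuple_code p x)).
  apply: rec_eqn; first by rec.
  by apply: (rec_comp rt); rec.
move=> x c; apply/eqP/eqP => [/tuple_code_inj <-|->]; first by rewrite kappaK.
by rewrite /kcode kappa_invK.
Qed.

Hypothesis n_gt0 : 0 < n.
Variable theta : nat -> partial_fun n.
Hypothesis theta_qgn : quasi_goedel p A theta.

(** QGN I in relational form: at stage [t] the enumeration [g] of the extended graph outputs the
    code of the point and the value shifted by one. *)
Lemma universal_enumeration :
  exists2 U, recursive_rel4 U & forall i, enumerates kap (U i) (theta i).
Proof.
have [_ [g rg gE] _] := theta_qgn; have rk := rec_kcode.
exists (fun i c y t => g t == p (p i (kcode c)) y.+1).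
  by move=> m f1 f2 f3 f4 r1 r2 r3 r4; rec_pairs.
move=> i c y.
(* [tuple_code] treats a one-entry sequence apart, so splitting off [i] relies on [n_gt0]. *)
have -> : p i (kcode c) = tuple_code p (cons_tuple i (kap c)).
  by rewrite /kcode /=; case: (val (kap c)) (size_tuple (kap c)) n_gt0 => //= <-.
have := extended_graph_succ p (universal_fun theta) (cons_tuple i (kap c)) y.
rewrite /universal_fun thead_cons behead_tuple_cons gE => <-.
by split=> [[t _ <-]|[t /eqP <-]]; exists t.
Qed.

(** QGN II in relational form: any uniform enumeration of members of [calS A n] is turned
    effectively into [theta] indices. *)
Lemma realization R : recursive_rel4 R ->
  exists2 v, recursive1 v &
    forall i q, calS A n q -> enumerates kap (R i) q -> theta (v i) = q.
Proof.
move=> rR; have [_ _ qgn2] := theta_qgn; have rk := rec_kcode.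
pose c s := pr1 p s; pose y s := pr1 p (pr2 p s); pose t s := pr2 p (pr2 p s).
(* [s] codes a point, a value and a counter. Counter 0 outputs the pair with second component 0,
   required at every point; counter [u.+1] tests the witness [u], and a failed test repeats a
   harmless 0. *)
pose k i s := p (kcode (c s))
  (if (0 < t s) && R i (c s) (y s) (t s).-1 then (y s).+1 else 0).
have [|v rv vE] := qgn2 k; first by rewrite /recursive2 /k /c /y /t; rec_pairs.
exists v => // i q Sq Rq; apply/esym/vE => //.
apply/seteqP; split=> [_ [s _ <-]|z [[x ->]|[x [w [qx ->]]]]].
- rewrite /k; case: ifP => [/andP[_ Rs]|_]; last by left; exists (kap (c s)).
  by right; exists (kap (c s)), (y s); split=> //; apply/Rq; exists (t s).-1.
- exists (p (kappa_inv kap x) (p 0 0)) => //.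
  by rewrite /k /c /y /t !(pr1K, pr2K) /= /kcode kappa_invK.
- have /Rq[u Ru] : q (kap (kappa_inv kap x)) = Some w by rewrite kappa_invK.
  exists (p (kappa_inv kap x) (p w u.+1)) => //.
  by rewrite /k /c /y /t !(pr1K, pr2K) /= Ru /kcode kappa_invK.
Qed.

Lemma total_theta h : recursive1 h ->
  exists m, forall c, theta m (kap c) = Some (h c).
Proof.
move=> rh; have [surj _ _] := theta_qgn; have rk := rec_kappa_inv.
have : calS A n (fun x => Some (h (kappa_inv kap x))).
  by left; exists (fun x => h (kappa_inv kap x)) => //; rec.
by rewrite -surj => -[m _ mE]; exists m => c; rewrite mE kappaK.
Qed.

Lemma theta_calS i : calS A n (theta i).
Proof. by have [<- _ _] := theta_qgn; exists i. Qed.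

Lemma recursion_theorem R (q : nat -> partial_fun n) :
  recursive_rel4 R -> (forall i, calS A n (q i)) ->
  (forall i, enumerates kap (R i) (q i)) -> exists e, theta e = q e.
Proof.
move=> rR Sq Rq; have [v rv vE] := realization rR.
have [U rU UE] := universal_enumeration.
(* [t] packs a stage [s] at which [theta i] yields [j] at the point numbered [i], that value [j],
   and a stage [u] for the run of [theta j]. *)
pose s t := pr1 p t; pose j t := pr1 p (pr2 p t); pose u t := pr2 p (pr2 p t).
pose D i c y t := U i i (j t) (s t) && U (j t) c y (u t).
have [|d rd dE] := @realization D.
  by move=> m f1 f2 f3 f4 r1 r2 r3 r4; rewrite /D /s /j /u; rec_pairs.
(* [m] computes [v (d i)] at the point numbered [i]. On the diagonal, [theta (d m)] is therefore
   [theta (v (d m))], which is [q (d m)]; the fixed point is [d m]. *)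
have [|m mE] := @total_theta (fun i => v (d i)); first by rewrite /recursive1; rec.
exists (d m); rewrite -(vE (d m) (q (d m))) //.
apply: dE => [|c y]; first exact: theta_calS.
split=> [/UE[w Uw]|[t /andP[Us Uu]]].
  have /UE[w' Uw'] := mE m.
  by exists (p w' (p (v (d m)) w)); rewrite /D /s /j /u !(pr1K, pr2K) Uw'.
have : theta m (kap m) = Some (j t) by apply/UE; exists (s t).
by rewrite mE => -[->]; apply/UE; exists (u t).
Qed.

(** * Upward closure and finite parts for completely c.e. sets *)

Section CompletelyCe.
Variables (X : set (partial_fun n)) (fI : nat -> nat).
Hypothesis fI_recursive : recursive1 fI.
Hypothesis fI_range : [set i | X (theta i)] = range fI.

Lemma completely_ceP i : X (theta i) <-> exists s, fI s = i.
Proof.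
have -> : X (theta i) = range fI i by rewrite -fI_range.
by split=> [[s _ <-]|[s <-]]; exists s.
Qed.

Lemma completely_ce_upward q r : calS A n q -> calS A n r ->
  (forall x y, q x = Some y -> r x = Some y) -> X q -> X r.
Proof.
move=> Sq Sr qr Xq; apply: contrapT => nXr.
have [surj _ _] := theta_qgn; have [U rU UE] := universal_enumeration.
have [a _ aq] : range theta q by rewrite surj.
have [b _ br] : range theta r by rewrite surj.
(* [t] packs a stage of [U] and a stage of [fI]: [q] is listed unconditionally, [r] once [i] shows
   up in the index set. *)
pose R i c y t := U a c y (pr1 p t) || (fI (pr2 p t) == i) && U b c y (pr1 p t).
pose f i := if `[< X (theta i) >] then r else q.
have [||i c y|e] := @recursion_theorem R f.
- by move=> m f1 f2 f3 f4 r1 r2 r3 r4; rewrite /R; rec_pairs.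
- by move=> i; rewrite /f; case: ifP.
- rewrite /f -aq -br; case: asboolP => [/completely_ceP[s si]|nXi].
    split=> [/UE[t Ut]|[t /orP[Ut|/andP[_ Ut]]]].
    + by exists (p t s); rewrite /R pr1K pr2K si eqxx Ut orbT.
    + by rewrite br; apply: qr; rewrite -aq; apply/UE; exists (pr1 p t).
    + by apply/UE; exists (pr1 p t).
  split=> [/UE[t Ut]|[t /orP[Ut|/andP[/eqP st _]]]].
  + by exists (p t 0); rewrite /R pr1K Ut.
  + by apply/UE; exists (pr1 p t).
  + by case: nXi; apply/completely_ceP; exists (pr2 p t).
(* If [theta e] is in [X], it equals [r], which is not; otherwise it equals [q], which is. *)
- by rewrite /f; case: asboolP => Xe eE; [apply: nXr; rewrite -eE|apply: Xe; rewrite eE].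
Qed.

Lemma completely_ce_compact (A_infinite : infinite_set A) fA (fA_recursive : recursive1 fA)
  (fA_range : range fA = A) q : calS A n q -> X q ->
  exists2 r, Anf A n r & X r /\ forall x y, r x = Some y -> q x = Some y.
Proof.
(* A member of [Anf A n] is its own finite part; only a total recursive [q] needs the diagonal
   argument. *)
case=> [|Aq Xq]; last by exists q.
move=> [f0 rf0 ->] Xq; apply: contrapT => noX.
pose h c := f0 (kap c).
have rh : recursive1 h.
  apply: (rec_comp rf0) => j.
  exact: (recursive1P (kappa_recursive kap j) (rec_tnth _ (@rec_tuple_id _))).
(* [b] finds a box of side in [A] containing all points numbered up to a given stage. *)
have [|x|b rb bE] := @rec_search 1 (fun x b => tnth x ord0 < fA b ^ n); first by rec.
  have [a Aa xa] := infinite_unbounded A_infinite (tnth x ord0).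
  move: Aa; rewrite -fA_range => -[k _ ka]; exists k; rewrite ka.
  exact: leq_trans xa (leq_self_exp _ n_gt0).
pose B s := fA (b [tuple s]).
have rB : recursive1 B.
  apply: (recursive1P fA_recursive); apply: recursive_ext rb => x.
  by congr b; apply: eq_from_tnth => j; rewrite !ord1.
have B_gt s : s < B s ^ n by have [] := bE [tuple s].
(* A point [c] is kept if [i] has not shown up by stage [c], or if [s] is the first stage showing
   [i] and [c] lies in the box of side [B s]. *)
pose D i c s := ~~ has (fun s' => fI s' == i) (iota 0 c.+1) ||
  [&& fI s == i, ~~ has (fun s' => fI s' == i) (iota 0 s) & c < B s ^ n].
pose R i c y s := (y == h c) && D i c s.
pose f i x := if `[< exists s, D i (kappa_inv kap x) s >] then Some (f0 x) else None.
have f_sub i x y : f i x = Some y -> Some (f0 x) = Some y by rewrite /f; case: ifP.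
have f_out i : ~ X (theta i) -> f i = fun x => Some (f0 x).
  move=> nXi; apply/funext => x; rewrite /f; case: asboolP => // -[]; exists 0.
  apply/orP; left; apply/hasPn => s _; apply/eqP => si.
  by apply: nXi; apply/completely_ceP; exists s.
have f_in i : X (theta i) -> Anf A n (f i).
  move=> /completely_ceP Xi.
  have /ex_minnP[s /eqP si s_min] : exists s, fI s == i by case: Xi => s <-; exists s.
  right; exists (B s); first by rewrite -fA_range; exists (b [tuple s]).
  have no_s : ~~ has (fun s' => fI s' == i) (iota 0 s).
    apply/hasPn => s'; rewrite mem_iota /= add0n => s's.
    by apply: contraTN s's => /s_min; rewrite -leqNgt.
  apply/seteqP; split=> x; have := kappa_box kap (B s) (kappa_inv kap x);
    rewrite kappa_invK => box_x; rewrite /dom /f /=; case: asboolP => //.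
  - case=> t Dx _; apply/box_x; case/orP: Dx => [/hasPn noc|/and3P[/eqP ti not c_lt]].
      (* Points kept by the first clause have number at most [s], hence lie in the box by [B_gt]. *)
      rewrite (leq_trans _ (B_gt s)) // ltnS leqNgt; apply/negP => sc.
      by have := noc s; rewrite mem_iota si eqxx /= add0n ltnS ltnW // => /(_ isT).
    suff -> : s = t by [].
    apply/eqP; rewrite eqn_leq s_min ?ti //= leqNgt; apply/negP => st.
    by move/hasPn/(_ s): not; rewrite mem_iota si eqxx /= add0n st => /(_ isT).
  - by move=> noD /box_x c_lt; case: noD; exists s; rewrite /D si eqxx no_s c_lt orbT.
have [||i c y|e eE] := @recursion_theorem R f.
- by move=> m f1 f2 f3 f4 r1 r2 r3 r4; rewrite /R /D; rec_pairs.
- move=> i; have [/f_in|/f_out ->] := pselect (X (theta i)); first by right.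
  by left; exists f0.
- rewrite /f /R kappaK; case: asboolP => [[s Ds]|noD]; split=> //.
  + by case=> <-; exists s; rewrite eqxx.
  + by case=> t /andP[/eqP ->].
  + by case=> t /andP[_ Dt]; case: noD; exists t.
(* If [theta e] is in [X], then [f e] is a finite part of [q] in [X], against [noX]; otherwise
   nothing was cut and [theta e] is [q] itself. *)
have [Xe|nXe] := pselect (X (theta e)).
  by case: noX; exists (f e); [exact: f_in|split; [rewrite -eE|exact: f_sub]].
by apply: (nXe); rewrite eE f_out.
Qed.

End CompletelyCe.
End QuasiGoedel.

(** * Both directions of the equivalence *)

Lemma bounded_collection (P : nat -> nat -> Prop) N :
  (forall c, c < N -> exists u, P c u) ->
  exists m, forall c, c < N -> exists2 u, u < m & P c u.
Proof.
elim: N => [|N IH] exP; first by exists 0.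
have [c c_lt|m mP] := IH; first by apply: exP; exact: ltnW.
have [u Pu] := exP N (ltnSn N); exists (maxn m u.+1) => c.
rewrite ltnS leq_eqVlt => /orP[/eqP ->|/mP[w w_lt Pw]].
  by exists u => //; rewrite leq_max ltnSn orbT.
by exists w => //; rewrite leq_max w_lt.
Qed.

Theorem theorem6p3
  (p : pairing) (cod : seq_coding)
  (A : set nat) (A_infinite : infinite_set A) (A_ce : ce A)
  (fA : nat -> nat) (fA_recursive : recursive1 fA) (fA_range : range fA = A)
  (n : nat) (n_ge1 : 1 <= n) (kap : tuple_enum n)
  (theta : nat -> partial_fun n) (theta_qgn : quasi_goedel p A theta)
  (X : set (partial_fun n)) (X_sub : X `<=` calS A n) :
  completely_ce theta X <->
  exists C : set nat, ce C /\
    X = [set r | calS A n r /\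
          exists2 i, C i & graph p (alpha p kap cod fA i) `<=` graph p r].
Proof.
have [sz [value [rsz rvalue alphaE AnfE]]] :=
  alpha_effective p cod kap n_ge1 A_infinite fA_recursive fA_range.
have [surj _ _] := theta_qgn; split=> [|[C [ceC XE]]].
  case=> [I0|[fI rfI fIE]].
    (* Surjectivity of [theta] makes [X] empty when its index set is. *)
    exists set0; split; first by left.
    apply/seteqP; split=> [r Xr|r [_ []]//].
    have [i _ ir] : range theta r by rewrite surj; exact: X_sub.
    have : [set i | X (theta i)] i by rewrite /= ir.
    by rewrite I0.
  have [|v rv vE] := realization kap theta_qgn
      (R := fun i c y _ => (c < sz i) && (y == value i c)).
    by move=> m f1 f2 f3 f4 r1 r2 r3 r4; rec.
  have Salpha i : calS A n (alpha p kap cod fA i) by right; rewrite AnfE; exists i.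
  have {}vE i : theta (v i) = alpha p kap cod fA i.
    apply: vE => // c y; rewrite alphaE; case: ifP => _ /=; last by split=> // -[].
    by split=> [[->]|[_ /eqP ->]] //; exists 0.
  (* [v] translates [alpha] indices into [theta] indices, so [C] is the preimage of the index set of
     [X] under [v]. *)
  exists [set i | exists s, fI s == v i]; split.
    by apply: (ce_projection p) => m f g rf rg; rec.
  have Calpha i : (exists s, fI s == v i) <-> X (alpha p kap cod fA i).
    rewrite -vE (completely_ceP fIE).
    by split=> -[s si]; exists s; apply/eqP.
  apply/seteqP; split=> [r Xr|r [Sr [i /Calpha Xi /graph_subset sub]]]; last first.
    exact: (completely_ce_upward kap n_ge1 theta_qgn rfI fIE (Salpha i) Sr sub).
  split; first exact: X_sub.
  have [q Aq [Xq qr]] := completely_ce_compact kap n_ge1 theta_qgn rfI fIE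
    A_infinite fA_recursive fA_range (X_sub _ Xr) Xr.
  move: Aq; rewrite AnfE => -[i _ iq]; exists i; first by apply/Calpha; rewrite iq.
  by apply/graph_subset; rewrite iq.
case: ceC => [C0|[fC rfC CE]].
  left; apply/seteqP; split=> // i /=; rewrite XE => -[_ [j]].
  by rewrite C0.
have [U rU UE] := universal_enumeration kap n_ge1 theta_qgn.
(* [w] codes a stage [s] of the enumeration of [C] and a time bound; the test is that [theta e]
   shows every value of [alpha (fC s)] within the bound. *)
pose check e w := all (fun c => has (fun u => U e c (value (fC (pr1 p w)) c) u)
  (iota 0 (pr2 p w))) (iota 0 (sz (fC (pr1 p w)))).
have -> : completely_ce theta X = ce [set e | exists w, check e w].
  congr ce; apply/seteqP; split=> e /=; rewrite XE.
    move=> [_ [i]]; rewrite CE => -[s _ <-] /graph_subset sub.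
    (* The domain of [alpha (fC s)] is finite, so one bound serves all its points. *)
    have [c c_lt|m mE] := @bounded_collection
        (fun c u => U e c (value (fC s) c) u) (sz (fC s)).
      by apply/UE/sub; rewrite alphaE c_lt.
    exists (p s m); rewrite /check pr1K pr2K; apply/allP => c.
    rewrite mem_iota => /mE[u u_lt Uu]; apply/hasP; exists u => //.
    by rewrite mem_iota.
  move=> [w /allP wE]; split; first exact: theta_calS theta_qgn e.
  exists (fC (pr1 p w)); first by rewrite CE; exists (pr1 p w).
  apply/graph_subset => x y; rewrite -(kappa_invK kap x) alphaE.
  case: ifP => // c_lt [<-]; apply/UE.
  by have := wE (kappa_inv kap x); rewrite mem_iota => /(_ c_lt)/hasP[u _ Uu]; exists u.
by apply: (ce_projection p) => m f g rf rg; rewrite /check; rec_pairs.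
Qed.
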